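(* Let $D$ be an integral domain and, for a semistar operation $\star$ on $D$, let $[\star]$ be the semistar operation on $D[X]$ defined in the context. Then $[w_D]=[t_D]=[v_D]=\widetilde{v_{D[X]}}=w_{D[X]}$.
   Context: $D$ has quotient field $K$; $X,Y$ are indeterminates; $D_1:=D[X]$, $K_1:=K(X)$. A semistar operation on a domain $A$ is a map $E\mapsto E^\star$ on nonzero $A$-submodules of the quotient field with $(xE)^\star=xE^\star$, monotone, extensive and idempotent. $E^{\star_f}=\bigcup\{F^\star\mid F\subseteq E,\ F$ nonzero finitely generated$\}$. Quasi-$\star$-ideal: nonzero ideal $I$ with $I^\star\cap A=I$; $\mathrm{QMax}^\star(A)$: maximal proper quasi-$\star$-ideals; $E^{\widetilde\star}=\bigcap\{EA_P\mid P\in\mathrm{QMax}^{\star_f}(A)\}$. $v_A$: $E\mapsto(A:(A:E))$; $t_A:=(v_A)_f$; $w_A:=\widetilde{v_A}$. For a semistar operation $\star$ on $D$: $\boldsymbol\Delta_1^\star:=\{Q_1\in\mathrm{Spec}(D_1)\mid Q_1\cap D=(0),\ \text{or } Q_1=(Q_1\cap D)[X]\text{ and }(Q_1\cap D)^{\star_f}\subsetneq D^\star\}$; $\mathcal S_1^\star:=D_1[Y]\setminus\bigcup\{Q_1[Y]\mid Q_1\in\boldsymbol\Delta_1^\star\}$; $[\star]$ is the semistar operation on $D_1$ given by $E^{[\star]}:=E[Y]_{\mathcal S_1^\star}\cap K_1$, with $E[Y]_{\mathcal S_1^\star}$ the $D_1[Y]_{\mathcal S_1^\star}$-submodule of $K(X,Y)$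 generated by $E$. *)

(* Defs.v *)
From HB Require Import structures.
From mathcomp Require Import all_boot all_order all_algebra.
Set Implicit Arguments. Unset Strict Implicit. Unset Printing Implicit Defensive.
Import GRing.Theory.
Local Open Scope ring_scope.

(* A domain is modelled as a subring A of a field F which is its quotient
   field.  Subsets of F are predicates F -> Prop. *)

Section Generic.
Variable F : fieldType.
Implicit Types (A B E G I P : F -> Prop).

Definition set_eq (E G : F -> Prop) := forall z, E z <-> G z.
Definition set_sub (E G : F -> Prop) := forall z, E z -> G z.

Definition domain_with_qf A :=
  [/\ A 1, (forall x y, A x -> A y -> A (x - y)),
      (forall x y, A x -> A y -> A (x * y)) &
      (forall z, exists a b, [/\ A a, A b, b != 0 & z = a / b])].

Definition submod A E :=
  [/\ E 0, (forall x y, E x -> E y -> E (x + y)) &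
      (forall a x, A a -> E x -> E (a * x))].
Definition nonzero E := exists x, E x /\ x != 0.
Definition nz_submod A E := submod A E /\ nonzero E.

Definition scale_set (x : F) E := fun z => exists e, E e /\ z = x * e.

Definition span B (s : seq F) := fun z =>
  exists c : seq F, [/\ size c = size s, (forall a, a \in c -> B a) &
                        z = \sum_(i < size s) c`_i * s`_i].
Definition genmod B E := fun z =>
  exists s : seq F, (forall x, x \in s -> E x) /\ span B s z.

Definition semistar A (st : (F -> Prop) -> (F -> Prop)) :=
  [/\ (forall E, nz_submod A E -> nz_submod A (st E)),
      (forall x E, x != 0 -> nz_submod A E ->
                   set_eq (st (scale_set x E)) (scale_set x (st E))),
      (forall E G, nz_submod A E -> nz_submod A G -> set_sub E G ->
                   set_sub (st E) (st G)),
      (forall E, nz_submod A E -> set_sub E (st E)) &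
      (forall E, nz_submod A E -> set_eq (st (st E)) (st E))].

Definition star_f A (st : (F -> Prop) -> (F -> Prop)) E := fun z =>
  exists s : seq F, [/\ (forall x, x \in s -> E x), has (fun x => x != 0) s &
                        st (span A s) z].

Definition colon A E := fun x => forall e, E e -> A (x * e).
Definition v_op A E := colon A (colon A E).
Definition t_op A := star_f A (v_op A).

Definition quasi_ideal A st I :=
  [/\ submod A I, set_sub I A, nonzero I & set_eq (fun x => st I x /\ A x) I].
Definition proper A I := exists x, A x /\ ~ I x.
Definition QMax A st P :=
  [/\ quasi_ideal A st P, proper A P &
      forall J, quasi_ideal A st J -> proper A J -> set_sub P J -> set_sub J P].

Definition locS A (S : F -> Prop) := fun z => exists a s, [/\ A a, S s & z = a / s].
Definition loc A P := locS A (fun s => A s /\ ~ P s).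

Definition tilde A st E := fun z =>
  forall P, QMax A (star_f A st) P -> genmod (loc A P) E z.
Definition w_op A := tilde A (v_op A).

Definition prime_ideal A Q :=
  [/\ submod A Q, set_sub Q A, proper A Q &
      forall a b, A a -> A b -> Q (a * b) -> Q a \/ Q b].

End Generic.

(* Polynomial constructions.  K1 := K(X), modelled as the fraction field of
   {poly K}; K2 := K1(Y) = K(X,Y). *)
Section Poly.
Variable K : fieldType.
Notation K1 := {fraction {poly K}}.
Notation K2 := {fraction {poly K1}}.
Notation "x %:F" := (@FracField.tofrac _ x).

Definition embK (c : K) : K1 := (c%:P)%:F.
Definition emb1 (z : K1) : K2 := (z%:P)%:F.

Definition polyset (B : K -> Prop) : K1 -> Prop :=
  fun z => exists p : {poly K}, (forall i, B p`_i) /\ z = p%:F.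
Definition polyset1 (B : K1 -> Prop) : K2 -> Prop :=
  fun z => exists p : {poly K1}, (forall i, B p`_i) /\ z = p%:F.

Variable D : K -> Prop.
Definition D1 := polyset D.
Definition contr (Q : K1 -> Prop) : K -> Prop := fun d => D d /\ Q (embK d).

Definition Delta1 (st : (K -> Prop) -> (K -> Prop)) (Q : K1 -> Prop) :=
  prime_ideal D1 Q /\
  ((forall d, contr Q d -> d = 0) \/
   (set_eq Q (polyset (contr Q)) /\
    set_sub (star_f D st (contr Q)) (st D) /\
    exists z, st D z /\ ~ star_f D st (contr Q) z)).

Definition S1 st : K2 -> Prop := fun z =>
  polyset1 D1 z /\ forall Q, Delta1 st Q -> ~ polyset1 Q z.

Definition bracket st (E : K1 -> Prop) : K1 -> Prop := fun z =>
  genmod (locS (polyset1 D1) (S1 st)) (fun y => exists e, E e /\ y = emb1 e)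
         (emb1 z).
End Poly.

(* Main.v *)
Require Import Defs.
From HB Require Import structures.
From mathcomp Require Import all_boot all_order all_algebra qpoly zify ring.
From mathcomp Require Import boolp classical_sets.
Set Implicit Arguments. Unset Strict Implicit. Unset Printing Implicit Defensive.
Import Defs GRing.Theory.
Local Open Scope ring_scope.

(* On both sides an element z belongs to the closure of E exactly when zJ is
   contained in E for some nonzero finitely generated ideal J of D[X] with
   J^v = D[X].  For w this follows from Zorn's lemma: an ideal that contains no
   such J lies in a prime maximal quasi-t-ideal.  For the bracket, clearing
   denominators gives g in S_1 with zg in E[Y], and one takes for J the content
   of g; it must be shown that J lies in no Q of Delta_1 iff J^v = D[X].
   If xJ is contained in D[X] and J is in no Q with zero contraction, then no
   irreducible polynomial of K[X] divides J, so x is in K[X]; if moreover J is in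
   no P[X] with P a maximal quasi-t-ideal of D, the coefficients of J generate an
   ideal of D with v-closure D, and McCoy's theorem for the D-module K/D puts x
   in D[X].  On finitely generated ideals, "the closure contains 1" means the
   same for v, t and w, so Delta_1 does not distinguish them. *)

(** * Subrings, spans of finite sequences, generated submodules and localization *)

Section Spans.
Variable F : fieldType.
Implicit Types (A B E G S : F -> Prop) (s : seq F).

Definition subring A :=
  [/\ A 1, (forall x y, A x -> A y -> A (x - y)) &
      (forall x y, A x -> A y -> A (x * y))].

Lemma domain_subring A : domain_with_qf A -> subring A.
Proof. by case=> ? ? ? _; split. Qed.

Lemma subring0 A : subring A -> A 0.
Proof. by case=> A1 AB _; rewrite -(subrr 1); apply: AB. Qed.

Lemma subringD A x y : subring A -> A x -> A y -> A (x + y).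
Proof.
move=> HA Ax Ay; have [_ AB _] := HA.
have -> : x + y = x - (0 - y) by rewrite sub0r opprK.
by apply: (AB x) => //; apply: AB => //; exact: subring0.
Qed.

Lemma subring_submod A : subring A -> submod A A.
Proof.
move=> HA; split; first exact: subring0.
  by move=> x y; apply: subringD.
by case: HA.
Qed.

Lemma submod_sum A E (I : Type) (r : seq I) (P : pred I) (f : I -> F) :
  submod A E -> (forall i, P i -> E (f i)) -> E (\sum_(i <- r | P i) f i).
Proof. by case=> E0 ED _ Ef; elim/big_ind: _. Qed.

Lemma submodB A E x y : subring A -> submod A E -> E x -> E y -> E (x - y).
Proof.
move=> HA [_ ED EM] Ex Ey; apply: ED => //.
rewrite -mulN1r; apply: EM => //; have [A1 AB _] := HA.
by rewrite -sub0r; apply: AB => //; exact: subring0.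
Qed.

(** Isolates the one uncontrolled term in a coefficient of a product, for the arguments of Gauss and
    McCoy below. *)
Lemma submod_sum_term A E (I : finType) (j : I) (f : I -> F) : subring A ->
  submod A E -> E (\sum_i f i) -> (forall i, i != j -> E (f i)) -> E (f j).
Proof.
move=> HA mE; rewrite (bigD1 j) //= => Es Ef.
rewrite -[f j](addrK (\sum_(i | i != j) f i)).
by apply: (submodB HA mE Es); apply: submod_sum (mE) _.
Qed.

Lemma span_nil B z : span B [::] z <-> z = 0.
Proof.
split=> [[c [_ _ ->]]|->]; first by rewrite big_ord0.
by exists [::]; split => //; rewrite big_ord0.
Qed.

Lemma span_cons B y s z :
  span B (y :: s) z <-> exists b z', [/\ B b, span B s z' & z = b * y + z'].
Proof.
split=> [[[|b c] [] //= [szc] cB ->]|[b [_ [Bb [c [szc cB ->]] ->]]]].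
  exists b, (\sum_(i < size s) c`_i * s`_i); split.
  - by apply: cB; rewrite inE eqxx.
  - by exists c; split => // a ac; apply: cB; rewrite inE ac orbT.
  - by rewrite big_ord_recl.
exists (b :: c); split; rewrite /= ?szc ?big_ord_recl //.
by move=> a; rewrite inE => /predU1P[->//|/cB].
Qed.

Lemma span_submod A s : subring A -> submod A (span A s).
Proof.
move=> HA; have A0 := subring0 HA; have [_ _ AM] := HA.
elim: s => [|y s [s0 sD sM]].
  split; first exact/span_nil.
    by move=> x y /span_nil-> /span_nil->; apply/span_nil; rewrite addr0.
  by move=> a x _ /span_nil->; apply/span_nil; rewrite mulr0.
split.
- by apply/span_cons; exists 0, 0; rewrite mul0r addr0.
- move=> x z /span_cons[b [x' [Ab sx ->]]] /span_cons[c [z' [Ac sz ->]]].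
  apply/span_cons; exists (b + c), (x' + z'); split; first exact: subringD.
    exact: sD.
  by ring.
- move=> a x Aa /span_cons[b [x' [Ab sx ->]]].
  apply/span_cons; exists (a * b), (a * x'); split; [exact: AM | exact: sM |].
  by ring.
Qed.

Lemma mem_span A s y : subring A -> y \in s -> span A s y.
Proof.
move=> HA; have A0 := subring0 HA; have [A1 _ _] := HA.
elim: s => // x s IH; rewrite inE => /predU1P[->|ys]; apply/span_cons.
  exists 1, 0; rewrite mul1r addr0; split => //.
  by case: (span_submod s HA).
by exists 0, y; rewrite mul0r add0r; split => //; exact: IH.
Qed.

Lemma span_min A B E s z : subring A -> submod A E -> set_sub B A ->
  (forall y, y \in s -> E y) -> span B s z -> E z.
Proof.
move=> HA [E0 ED EM] BA; elim: s z => [|y s IH] z sE.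
  by move=> /span_nil->.
move=> /span_cons[b [z' [Bb sz ->]]]; apply: ED.
  by apply: EM; [exact: BA | apply: sE; rewrite inE eqxx].
by apply: IH sz => x xs; apply: sE; rewrite inE xs orbT.
Qed.

Lemma genmod0 B G : genmod B G 0.
Proof. by exists [::]; split => //; apply/span_nil. Qed.

Lemma genmod_cons B G b g z : B b -> G g -> genmod B G z -> genmod B G (b * g + z).
Proof.
move=> Bb Gg [s [sG sz]]; exists (g :: s); split; last first.
  by apply/span_cons; exists b, z.
by move=> x; rewrite inE => /predU1P[->|/sG].
Qed.

Lemma genmod_ind B G (P : F -> Prop) : P 0 ->
  (forall b g z, B b -> G g -> P z -> P (b * g + z)) ->
  forall z, genmod B G z -> P z.
Proof.
move=> P0 PS z [s [sG sz]]; elim: s z sG sz => [|y s IH] z sG.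
  by move=> /span_nil->.
move=> /span_cons[b [z' [Bb sz ->]]]; apply: PS => //.
  by apply: sG; rewrite inE eqxx.
by apply: IH sz => x xs; apply: sG; rewrite inE xs orbT.
Qed.

Lemma genmod_mul A B G a z : (forall b, B b -> A (a * b)) ->
  genmod B G z -> genmod A G (a * z).
Proof.
move=> BA; elim/genmod_ind => [|b g {}z Bb Gg IH]; first by rewrite mulr0; exact: genmod0.
by rewrite mulrDr mulrA; apply: genmod_cons => //; exact: BA.
Qed.

Lemma genmod_id A E z : subring A -> submod A E -> genmod A E z <-> E z.
Proof.
move=> HA [E0 ED EM]; split.
  by elim/genmod_ind => // b g {}z Ab Eg Ez; apply: ED => //; exact: EM.
move=> Ez; have [A1 _ _] := HA; rewrite -[z]mul1r -[_ * _]addr0.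
by apply: genmod_cons => //; exact: genmod0.
Qed.

(** The product of the denominators in a finite combination is a common denominator, and it stays in
    [S]. *)
Lemma genmod_locS A S G z : subring A -> S 1 ->
  (forall x y, S x -> S y -> S (x * y)) -> set_sub S A -> ~ S 0 ->
  genmod (locS A S) G z <-> exists2 s, S s & genmod A G (s * z).
Proof.
move=> HA S1 SM SA S0; have [A1 _ AM] := HA; split.
  elim/genmod_ind => [|_ g {}z [a [t [Aa St ->]]] Gg [s Ss sz]].
    by exists 1 => //; rewrite mulr0; exact: genmod0.
  have t0 : t != 0 by apply: contra_notN S0 => /eqP<-.
  exists (s * t); first exact: SM.
  have -> : s * t * (a / t * g + z) = (s * a) * g + t * (s * z) by field.
  apply: genmod_cons => //; first by apply: AM => //; exact: SA.
  by apply: genmod_mul sz => b Ab; apply: AM => //; exact: SA.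
move=> [s Ss sz]; have s0 : s != 0 by apply: contra_notN S0 => /eqP<-.
have -> : z = s^-1 * (s * z) by rewrite mulKf.
by apply: genmod_mul sz => b Ab; exists b, s; rewrite mulrC.
Qed.

End Spans.

(** * Glaz-Vasconcelos (GV) sequences, maximal quasi-t-ideals and the w-operation *)

Section GlazVasconcelos.
Variables (F : fieldType) (A : F -> Prop).
Hypothesis domA : domain_with_qf A.
Let ringA : subring A := domain_subring domA.
Implicit Types (E I J M P : F -> Prop) (s : seq F).

(* The v-closure of the ideal generated by [s] contains [1]; equivalently, its
   inverse is [A]. *)
Definition gv_seq s :=
  [/\ (forall y, y \in s -> A y), has (fun y => y != 0) s &
      (forall x, (forall y, y \in s -> A (x * y)) -> A x)].

Lemma gv_seq1 : gv_seq [:: 1].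
Proof.
have [A1 _ _] := ringA; split => [y||x H].
- by rewrite inE => /eqP->.
- by rewrite /= oner_neq0.
- by rewrite -[x]mulr1; apply: H; rewrite inE.
Qed.

(** If [x] multiplies all products into [A], then each [x * a] with [a] in [s] multiplies [s'] into
    [A]; so [x * a] is in [A] for all such [a], and then [x] is in [A]. *)
Lemma gv_seqM s s' : gv_seq s -> gv_seq s' -> gv_seq [seq y * y' | y <- s, y' <- s'].
Proof.
have [_ _ AM] := ringA.
move=> [sA /hasP[y ys y0] sG] [sA' /hasP[y' ys' y0'] sG']; split.
- by move=> _ /allpairsP[[a b] /= [/sA Aa /sA' Ab ->]]; exact: AM.
- apply/hasP; exists (y * y'); last by rewrite mulf_neq0.
  by apply/allpairsP; exists (y, y').
- move=> x H; apply: sG => a sa; apply: sG' => b sb; rewrite -mulrA.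
  by apply: H; apply/allpairsP; exists (a, b).
Qed.

Lemma gv_seq_span s s' : (forall y, y \in s -> A y) -> has (fun y => y != 0) s ->
  (forall y, y \in s' -> span A s y) -> gv_seq s' -> gv_seq s.
Proof.
move=> sA nzs ss' [_ _ G']; split => // x xs; apply: G' => y /ss'.
have [_ _ AM] := ringA.
apply: (@span_min _ A A (fun y => A (x * y)) s) => //; split.
- by rewrite mulr0; exact: subring0.
- by move=> a b xa xb; rewrite mulrDr; exact: subringD.
- by move=> a b Aa xb; rewrite mulrCA; exact: AM.
Qed.

Lemma v_op_span s z : v_op A (span A s) z <->
  forall x, (forall y, y \in s -> A (x * y)) -> A (z * x).
Proof.
have [_ _ AM] := ringA; split=> H x xs; apply: H; last first.
  by move=> y ys; apply: xs; exact: mem_span.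
move=> e; apply: (@span_min _ A A (fun y => A (x * y)) s) => //; split.
- by rewrite mulr0; exact: subring0.
- by move=> a b xa xb; rewrite mulrDr; exact: subringD.
- by move=> a b Aa xb; rewrite mulrCA; exact: AM.
Qed.

(* Ideals [J] whose t-closure does not contain [1]. *)
Definition gv_free J := forall s, (forall y, y \in s -> J y) -> ~ gv_seq s.

Definition t_proper J := [/\ submod A J, set_sub J A & gv_free J].

Lemma gv_free_neq1 J : gv_free J -> ~ J 1.
Proof.
by move=> Jf J1; apply: (Jf [:: 1]) gv_seq1 => y; rewrite inE => /eqP->.
Qed.

(** Being [t_proper] is tested on finitely many elements at a time, so it passes to unions of
    chains. Adjoining [I] to every member lets the empty chain contribute [I] itself. *)
Lemma t_proper_chain I (C : set (set F)) : t_proper I ->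
  (forall X, C X -> t_proper (X `|` I)%classic) ->
  total_on C subset -> t_proper ((\bigcup_(X in C) X) `|` I)%classic.
Proof.
move=> Igood Cgood Ctot; set U := (_ `|` _)%classic.
(* Since the chain is totally ordered, a finite sequence in the union already lies in [I] or in [Y]
   united with [I] for a single member [Y]. *)
have fin s : (forall y, y \in s -> U y) -> exists2 X,
    (X = I \/ exists2 Y, C Y & X = (Y `|` I)%classic) & forall y, y \in s -> X y.
  elim: s => [_|y s IH sU]; first by exists I; [left|].
  have [|X XC Xs] := IH; first by move=> x xs; apply: sU; rewrite inE xs orbT.
  have [[Y CY Yy]|Iy] := sU y (mem_head _ _); last first.
    exists X => // x; rewrite inE => /predU1P[->|/Xs//].
    by case: XC => [->//|[Y _ ->]]; right.
  case: XC Xs => [->|[Z CZ ->]] Xs.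
    exists (Y `|` I)%classic; first by right; exists Y.
    by move=> x; rewrite inE => /predU1P[->|/Xs]; [left|right].
  have [YZ|ZY] := Ctot _ _ CY CZ.
    exists (Z `|` I)%classic; first by right; exists Z.
    by move=> x; rewrite inE => /predU1P[->|/Xs//]; left; exact: YZ.
  exists (Y `|` I)%classic; first by right; exists Y.
  by move=> x; rewrite inE => /predU1P[->|/Xs[/ZY|]]; [left|left|right].
have sub X : (X = I \/ exists2 Y, C Y & X = (Y `|` I)%classic) ->
    t_proper X /\ set_sub X U.
  case=> [->|[Y CY ->]]; first by split => // z Iz; right.
  by split; [exact: Cgood | move=> z [Yz|Iz]; [left; exists Y|right]].
split; first split.
- by right; case: Igood => [[]].
- move=> x y Ux Uy; have [|X /sub[[[_ XD _] _ _] XU] Xs] := fin [:: x; y].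
    by move=> z; rewrite !inE => /orP[]/eqP->.
  by apply: XU; apply: XD; apply: Xs; rewrite !inE eqxx ?orbT.
- move=> a x Aa Ux; have [|X /sub[[[_ _ XM] _ _] XU] Xs] := fin [:: x].
    by move=> z; rewrite inE => /eqP->.
  by apply: XU; apply: XM => //; apply: Xs; rewrite inE.
- move=> x Ux; have [|X /sub[[_ XA _] _] Xs] := fin [:: x].
    by move=> z; rewrite inE => /eqP->.
  by apply: XA; apply: Xs; rewrite inE.
- by move=> s /fin[X /sub[[_ _ Xf] _]] /Xf.
Qed.

Lemma t_proper_max I : t_proper I -> exists M, [/\ set_sub I M, t_proper M &
  forall J, t_proper J -> set_sub M J -> set_sub J M].
Proof.
move=> Igood.
have [|L [Lgood Lmax]] :=
    @Zorn_bigcup F (fun X => t_proper (X `|` I)%classic).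
  by move=> C CP Ctot; apply: t_proper_chain.
exists (L `|` I)%classic; split => //; first by move=> z Iz; right.
move=> J Jgood LJ z Jz; apply: contrapT => nLz; apply: (Lmax J).
  by split; [move=> x Lx; apply: LJ; left | move=> JL; apply: nLz; left; exact: JL].
suff -> : (J `|` I)%classic = J by [].
by apply/seteqP; split => [x [//|Ix]|x Jx]; [apply: LJ; right|left].
Qed.

Lemma t_op_submod E : nonzero E -> submod A (t_op A E).
Proof.
move=> [e [Ee e0]]; have [_ _ AM] := ringA; split.
- exists [:: e]; split; [by move=> x; rewrite inE => /eqP->|by rewrite /= e0|].
  by apply/v_op_span => x _; rewrite mul0r; exact: subring0.
- move=> x y [s [sE nzs /v_op_span xs]] [s' [sE' _ /v_op_span ys]].
  exists (s ++ s'); split.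
  + by move=> z; rewrite mem_cat => /orP[/sE|/sE'].
  + by rewrite has_cat nzs.
  apply/v_op_span => z zs; rewrite mulrDl; apply: subringD => //.
    by apply: xs => u us; apply: zs; rewrite mem_cat us.
  by apply: ys => u us; apply: zs; rewrite mem_cat us orbT.
- move=> a x Aa [s [sE nzs /v_op_span xs]]; exists s; split => //.
  by apply/v_op_span => z zs; rewrite -mulrA; apply: AM => //; exact: xs.
Qed.

(** Finitely many elements of the t-closure of [J] lie in the v-closure of one finitely generated
    [span A s'] inside [J]. If they form a GV sequence, so does [s'], which [J] excludes. *)
Lemma t_proper_t_op J : t_proper J -> nonzero J ->
  t_proper (fun x => t_op A J x /\ A x).
Proof.
move=> [Jm JA Jf] nzJ; have [t0 tD tM] := t_op_submod nzJ.
have [A0 AD AM] := subring_submod ringA.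
split; first split.
- by [].
- by move=> x y [tx Ax] [ty Ay]; split; [exact: tD|exact: AD].
- by move=> a x Aa [tx Ax]; split; [exact: tM|exact: AM].
- by move=> x [].
move=> s sJ [_ nzs sG].
(* The sequence [s'] concatenates the witnesses of the entries of [s], starting from a nonzero
   element of [J]. *)
have [s' [sJ' nzs' ss']] : exists s', [/\ forall y, y \in s' -> J y,
    has (fun y => y != 0) s' & forall y, y \in s -> v_op A (span A s') y].
  elim: s sJ {nzs sG} => [|y s IH] sJ.
    have [j [Jj j0]] := nzJ; exists [:: j]; split => //=; last by rewrite j0.
    by move=> y; rewrite inE => /eqP->.
  have [|s1 [s1J nz1 ss1]] := IH.
    by move=> x xs; apply: sJ; rewrite inE xs orbT.
  have [[s2 [s2J _ /v_op_span ys2]] _] := sJ y (mem_head _ _).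
  exists (s1 ++ s2); split.
  - by move=> x; rewrite mem_cat => /orP[/s1J|/s2J].
  - by rewrite has_cat nz1.
  - move=> x; rewrite inE => /predU1P[->|/ss1/v_op_span xs1];
      apply/v_op_span => z zs.
      by apply: ys2 => u us; apply: zs; rewrite mem_cat us orbT.
    by apply: xs1 => u us; apply: zs; rewrite mem_cat us.
apply: (Jf s') => //; split => // [y /sJ'/JA //|x xs'].
by apply: sG => y /ss'/v_op_span/(_ x xs'); rewrite mulrC.
Qed.

Lemma t_op_id E x : nonzero E -> E x -> t_op A E x.
Proof.
move=> [e [Ee e0]] Ex; exists [:: x; e]; split.
- by move=> y; rewrite !inE => /orP[]/eqP->.
- by rewrite /= e0 orbT.
- by apply/v_op_span => z zs; rewrite mulrC; apply: zs; rewrite inE eqxx.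
Qed.

(** A GV sequence in [J] would put 1 in the t-closure of [J], hence in [J]. *)
Lemma quasi_proper_t_proper J :
  quasi_ideal A (t_op A) J -> proper A J -> t_proper J.
Proof.
have [A1 _ _] := ringA.
move=> [Jm JA nzJ tJ] [x [Ax nJx]]; split => // s sJ [sA nzs sG].
have J1 : J 1.
  apply/tJ; split => //; exists s; split => //; apply/v_op_span => z /sG.
  by rewrite mul1r.
by apply: nJx; rewrite -[x]mulr1; case: Jm => _ _; apply.
Qed.

(** For [a] and [b] outside [M], maximality yields GV sequences in [M + aA] and in [M + bA]. If
    [a * b] were in [M], their product would be a GV sequence in [M]. *)
Lemma t_proper_max_prime M : t_proper M ->
  (forall J, t_proper J -> set_sub M J -> set_sub J M) -> prime_ideal A M.
Proof.
move=> Mgood Mmax; have [Mm MA Mf] := Mgood; have [M0 MD MM] := Mm.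
have [A1 _ AM] := ringA; have [A0 AD _] := subring_submod ringA.
have step a : A a -> ~ M a -> exists2 s, gv_seq s &
    forall y, y \in s -> exists m r, [/\ M m, A r & y = m + a * r].
  move=> Aa nMa; pose J y := exists m r, [/\ M m, A r & y = m + a * r].
  apply: contrapT => nos; apply: nMa; apply: (Mmax J).
  - split; first split.
    + by exists 0, 0; rewrite mulr0 addr0.
    + move=> _ _ [m [r [Mm1 Ar ->]]] [n [q [Mn Aq ->]]].
      by exists (m + n), (r + q); split; [exact: MD|exact: AD|ring].
    + move=> b _ Ab [m [r [Mm1 Ar ->]]].
      by exists (b * m), (b * r); split; [exact: MM|exact: AM|ring].
    + move=> _ [m [r [Mm1 Ar ->]]]; apply: AD; [exact: MA|exact: AM].
    + by move=> s sJ sG; apply: nos; exists s.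
  - by move=> m Mm1; exists m, 0; rewrite mulr0 addr0.
  - by exists 0, 1; rewrite mulr1 add0r.
split => //; first by exists 1; split => //; exact: gv_free_neq1.
move=> a b Aa Ab Mab; have [Ma|nMa] := pselect (M a); first by left.
have [Mb|nMb] := pselect (M b); first by right.
have [s sG sJ] := step a Aa nMa; have [s' sG' sJ'] := step b Ab nMb.
case: (Mf _ _ (gv_seqM sG sG')).
move=> _ /allpairsP[[_ _] /= [/sJ[m [r [Mm1 Ar ->]]] /sJ'[n [q [Mn Aq ->]]] ->]].
have -> : (m + a * r) * (n + b * q) = (n + b * q) * m + (a * r) * n + (r * q) * (a * b).
  by ring.
apply: (MD); first apply: (MD); apply: MM => //; last exact: AM.
  by apply: AD; [exact: MA|exact: AM].
exact: AM.
Qed.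

(** A maximal [t_proper] ideal [M] is a quasi-t-ideal because the part of its t-closure in [A] is
    again [t_proper], hence contained in [M]. *)
Lemma exists_t_maximal I : t_proper I -> nonzero I -> exists M,
  [/\ set_sub I M, QMax A (t_op A) M, prime_ideal A M & gv_free M].
Proof.
move=> Igood [i [Ii i0]].
have [M [IM Mgood Mmax]] := t_proper_max Igood; exists M.
have [Mm MA Mf] := Mgood; have [A1 _ _] := ringA.
have nzM : nonzero M by exists i; split => //; exact: IM.
split => //; last exact: t_proper_max_prime.
split.
- split => // x; split.
    move=> tMx; apply: (Mmax _ (t_proper_t_op Mgood nzM)) tMx.
    by move=> y My; split; [exact: t_op_id|exact: MA].
  by move=> Mx; split; [exact: t_op_id|exact: MA].
- by exists 1; split => //; exact: gv_free_neq1.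
- by move=> J Jq Jp; apply: Mmax; exact: quasi_proper_t_proper.
Qed.

Lemma w_opP E z : nz_submod A E -> w_op A E z <->
  exists2 s, gv_seq s & forall y, y \in s -> E (z * y).
Proof.
move=> [Em nzE]; have [E0 ED EM] := Em; have [A1 _ AM] := ringA.
have [A0 AD _] := subring_submod ringA; split; last first.
  move=> [s sG zs] P [Pq Pp _].
  have [_ _ Pf] := quasi_proper_t_proper Pq Pp; have [sA _ _] := sG.
  (* [P] contains no GV sequence, so some entry [y] of [s] is invertible in the localization at [P],
     and [z] is [z * y] divided by [y]. *)
  have [y ys nPy] : exists2 y, y \in s & ~ P y.
    apply: contrapT => nos; apply: (Pf s) => // y ys.
    by apply: contrapT => nPy; apply: nos; exists y.
  have y0 : y != 0.
    by apply: contra_notN nPy => /eqP->; case: Pq => [[]].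
  have -> : z = (1 / y) * (z * y) + 0 by field.
  apply: genmod_cons (genmod0 _ _); last exact: zs.
  by exists 1, y; split => //; split => //; exact: sA.
move=> wz; apply: contrapT => nos.
(* The conductor of [z] into [E]. If it contains no GV sequence, it lies in a maximal quasi-t-ideal
   [M], and the localization at [M] gives a contradiction. *)
pose I a := A a /\ E (z * a).
have Igood : t_proper I.
  split; first split.
  - by split => //; rewrite mulr0.
  - by move=> a b [Aa za] [Ab zb]; split; [exact: AD|rewrite mulrDr; exact: ED].
  - by move=> a b Aa [Ab zb]; split; [exact: AM|rewrite mulrCA; exact: EM].
  - by move=> a [].
  - by move=> s sI sG; apply: nos; exists s => // y /sI[].
have nzI : nonzero I.
  have [e [Ee e0]] := nzE; have [_ _ _ frac] := domA.
  (* Writing [z / e] as [a / b] gives [z * b = a * e], so the nonzero [b] is in the conductor. *)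
  have [a [b [Aa Ab b0 zab]]] := frac (z / e).
  exists b; split => //; split => //.
  have -> : z * b = a * e by rewrite -[z](divfK e0) zab; field.
  exact: EM.
have [M [IM Mmax Mpr Mf]] := exists_t_maximal Igood nzI.
have [_ _ [u [Au nMu]] MP] := Mpr.
have nM1 := gv_free_neq1 Mf.
have /genmod_locS := wz M Mmax; case => //.
- by move=> x y [Ax nx] [Ay ny]; split; [exact: AM|case/MP].
- by move=> x [].
- by case=> _; apply; case: Mpr => [[]].
(* The denominator [y] lies outside [M], yet [y * z] is in [E], so [y] is in the conductor and hence
   in [M]. *)
- move=> y [Ay nMy] /(genmod_id _ ringA Em) Eyz.
  by apply: nMy; apply: IM; split => //; rewrite mulrC.
Qed.

End GlazVasconcelos.

(** * Agreement of v, t and w on finitely generated ideals *)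

Section StarOperations.
Variables (F : fieldType) (A : F -> Prop).
Hypothesis domA : domain_with_qf A.
Let ringA : subring A := domain_subring domA.
Implicit Types (st : (F -> Prop) -> F -> Prop).

(* The only facts about v, t and w that enter the definition of [Delta1]. *)
Definition gv_like st :=
  (forall z, st A z <-> A z) /\
  forall s, (forall y, y \in s -> A y) -> has (fun y => y != 0) s ->
    [/\ forall z, st (span A s) z -> A z, st (span A s) 1 -> gv_seq A s &
        gv_seq A s -> forall z, A z -> st (span A s) z].

Lemma v_op_gv_like : gv_like (v_op A).
Proof.
have [A1 _ AM] := ringA; split=> [z|s sA nzs].
  split=> [vz|Az x Ax]; first by rewrite -[z]mulr1; apply: vz => e Ae; rewrite mul1r.
  by apply: AM => //; rewrite -[x]mulr1; exact: Ax.
split.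
- by move=> z /v_op_span sz; rewrite -[z]mulr1; apply: sz => // y /sA; rewrite mul1r.
- by move=> /v_op_span s1; split => // x /(s1 domA); rewrite mul1r.
- move=> [_ _ sG] z Az; apply/v_op_span => // x /sG; exact: AM.
Qed.

(** A finite sequence in [span A s] again has entries in [A], so each clause follows from the one
    for v. *)
Lemma t_op_gv_like : gv_like (t_op A).
Proof.
have [A1 _ AM] := ringA; have [_ vs] := v_op_gv_like.
have spanA s y : (forall y, y \in s -> A y) -> span A s y -> A y.
  by move=> sA; apply: (@span_min _ A A A) => //; exact: subring_submod.
split=> [z|s sA nzs].
  split=> [[s [sA nzs]]|Az]; first by case: (vs s sA nzs) => + _ _; apply.
  by apply: t_op_id => //; exists 1; rewrite oner_neq0.
split.
- move=> z [s' [ss' nzs']].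
  by have [|+ _ _] := vs s' _ nzs'; [by move=> y /ss'; exact: spanA|apply].
- move=> [s' [ss' nzs' s1]]; have [|_ sG _] := vs s' _ nzs'.
    by move=> y /ss'; exact: spanA.
  by apply: gv_seq_span (sG s1).
- move=> sG z Az; exists s; split => //; first by move=> y; exact: mem_span.
  by case: (vs s sA nzs) => _ _; apply.
Qed.

(** By [w_opP], having 1 in the closure means that [span A s] contains a GV sequence; conversely a
    GV sequence [s] multiplies all of [A] into its own span. *)
Lemma w_op_gv_like : gv_like (w_op A).
Proof.
have [A1 _ AM] := ringA; have modA := subring_submod ringA.
have nzA : nonzero A by exists 1; rewrite oner_neq0.
split=> [z|s sA nzs].
  split=> [/w_opP[//|//|s [_ _ sG] zs]|Az]; first exact: sG.
  by apply/w_opP => //; exists [:: 1] => [|y];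
    [exact: gv_seq1|rewrite inE => /eqP->; exact: AM].
have nzsp : nz_submod A (span A s).
  split; first exact: span_submod.
  by have /hasP[y ys y0] := nzs; exists y; split => //; exact: mem_span.
have spanA y : span A s y -> A y by apply: (@span_min _ A A A).
split.
- by move=> z /w_opP[//|//|s' [_ _ sG] zs]; apply: sG => y /zs /spanA.
- move=> /w_opP[//|//|s' sG zs]; apply: (gv_seq_span _ _ _ _ sG) => // y /zs.
  by rewrite mul1r.
- move=> sG z Az; apply/w_opP => //; exists s => // y ys.
  by case: nzsp => [[_ _ spM] _]; apply: spM => //; exact: mem_span.
Qed.

Lemma common_denominator (s : seq F) :
  exists d, [/\ A d, d != 0 & forall y, y \in s -> A (d * y)].
Proof.
have [A1 _ AM] := ringA; have [_ _ _ frac] := domA.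
elim: s => [|y s [d [Ad d0 ds]]]; first by exists 1; rewrite oner_neq0.
have [a [b [Aa Ab b0 ->]]] := frac y; exists (d * b); split.
- exact: AM.
- by rewrite mulf_neq0.
- move=> x; rewrite inE => /predU1P[->|/ds].
    by rewrite -mulrA [b * _]mulrC divfK //; exact: AM.
  by rewrite mulrAC => dx; exact: AM.
Qed.

End StarOperations.

(** * Polynomials with coefficients in a submodule, extended primes and McCoy's argument *)

Section Polyset.
Variable K : fieldType.
Notation "x %:F" := (@FracField.tofrac _ x).
Implicit Types (B P D : K -> Prop) (p q : {poly K}).

Lemma polyset_tofrac B p : polyset B p%:F <-> forall i, B p`_i.
Proof.
split=> [[q [Bq /eqP]]|Bp]; last by exists p.
by rewrite tofrac_eq => /eqP->.
Qed.

Variable D : K -> Prop.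
Hypothesis ringD : subring D.

Lemma subring_polyset : subring (polyset D).
Proof.
have D0 := subring0 ringD; have [_ DD _] := subring_submod ringD.
have [D1' DB DM] := ringD; split.
- rewrite -tofrac1; apply/polyset_tofrac => i; rewrite coef1.
  by case: (i == 0%N).
- move=> _ _ [p [Dp ->]] [q [Dq ->]]; rewrite -tofracB; apply/polyset_tofrac => i.
  by rewrite coefB; exact: DB.
- move=> _ _ [p [Dp ->]] [q [Dq ->]]; rewrite -tofracM; apply/polyset_tofrac => i.
  rewrite coefM; apply: submod_sum (subring_submod ringD) _ => j _; exact: DM.
Qed.

Lemma polyset_submod P : submod D P -> submod (polyset D) (polyset P).
Proof.
move=> mP; have [P0 PD PM] := mP; split.
- by rewrite -tofrac0; apply/polyset_tofrac => i; rewrite coef0.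
- move=> _ _ [p [Dp ->]] [q [Dq ->]]; rewrite -tofracD; apply/polyset_tofrac => i.
  by rewrite coefD; exact: PD.
- move=> _ _ [p [Dp ->]] [q [Dq ->]]; rewrite -tofracM; apply/polyset_tofrac => i.
  by rewrite coefM; apply: submod_sum mP _ => j _; exact: PM.
Qed.

Lemma polyset_sub B B' : set_sub B B' -> set_sub (polyset B) (polyset B').
Proof. by move=> BB' _ [p [Bp ->]]; exists p; split => // i; exact: BB'. Qed.

Lemma polyset_const B c : B 0 -> polyset B (c%:P)%:F <-> B c.
Proof.
move=> B0; split=> [/polyset_tofrac/(_ 0%N)|Bc]; first by rewrite coefC.
by apply/polyset_tofrac => i; rewrite coefC; case: (i == 0%N).
Qed.

(* As for Gauss's lemma: look at the lowest coefficients outside [P]. *)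
Lemma polyset_prime P : prime_ideal D P -> prime_ideal (polyset D) (polyset P).
Proof.
move=> [mP PD [u [Du nPu]] PM]; have [P0 _ _] := mP.
have [P0' PDD PMM] := mP; have [D1' _ DM] := ringD.
split; first exact: polyset_submod.
- exact: polyset_sub.
- exists (u%:P)%:F; split; first by apply/polyset_const => //; exact: subring0.
  by move=> /polyset_const-/(_ P0).
have least p : ~ polyset P p%:F -> exists n, ~ P p`_n /\ forall i, (i < n)%N -> P p`_i.
  move=> nPp; have ex : exists n, `[< ~ P p`_n >].
    apply: contrapT => nex; apply: nPp; apply/polyset_tofrac => i.
    by apply: contrapT => nPi; apply: nex; exists i; apply/asboolP.
  exists (ex_minn ex); case: ex_minnP => n /asboolP nPn nmin; split => // i ltin.
  apply: contrapT => nPi; have /nmin : `[< ~ P p`_i >] by exact/asboolP.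
  by rewrite leqNgt ltin.
move=> _ _ [p [Dp ->]] [q [Dq ->]]; rewrite -tofracM => /polyset_tofrac Ppq.
have [Pp|/least[m [nPm mP']]] := pselect (polyset P p%:F); first by left.
have [Pq|/least[n [nPn nP']]] := pselect (polyset P q%:F); first by right.
suff /PM[] : P (p`_m * q`_n) by [].
have ltm : (m < (m + n).+1)%N by rewrite ltnS leq_addr.
(* In this coefficient every term other than [p]_m * q[_n] has a factor of index below [m] or below
   [n], which is in [P]. *)
have := Ppq (m + n)%N; rewrite coefM.
move=> /(submod_sum_term (j := Ordinal ltm) ringD mP) /=; rewrite addKn.
apply=> i neim.
case: (ltngtP i m) => [ltim|ltmi|eqim].
- by rewrite mulrC; apply: PMM => //; exact: mP'.
- apply: PMM => //; apply: nP'; have := ltn_ord i; lia.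
- by case/eqP: neim; apply/val_inj.
Qed.

(* McCoy's argument for the module [K / D]: a polynomial [u] of least size
   outside [D[X]] would be multiplied into [D[X]] by each coefficient. *)
Lemma mccoy (ps : seq {poly K}) :
  (forall g, g \in ps -> forall i, D g`_i) ->
  (forall x, (forall g i, g \in ps -> D (x * g`_i)) -> D x) ->
  forall u, (forall g, g \in ps -> forall i, D (u * g)`_i) -> forall i, D u`_i.
Proof.
move=> psD psG u; have [n] := ubnP (size u).
have D0 := subring0 ringD; have [D1' DB DM] := ringD.
elim: n u => // n IH u /ltnSE szu ups k.
have [->|u0] := eqVneq u 0; first by rewrite coef0.
apply: psG => g i gps; rewrite mulrC -coefZ; move: i k.
(* Descending induction on [i]: the coefficients of [g] of index above [i] are already known to
   multiply [u] into D[X]. *)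
suff main m i : (size g <= i + m)%N -> forall k, D (g`_i *: u)`_k.
  by move=> i; apply: (main (size g)); rewrite leq_addl.
elim: m i => [|m IHm] i.
  by rewrite addn0 => /leq_sizeP/(_ i (leqnn i))-> k; rewrite scale0r coef0.
move=> szg; set d := (size u).-1.
(* In the coefficient of index [d + i] of [u * g], terms with [j < d] involve a coefficient of [g]
   of index above [i], and those with [j > d] vanish. *)
have lead : D (g`_i * u`_d).
  have ltd : (d < (d + i).+1)%N by rewrite ltnS leq_addr.
  have := ups g gps (d + i)%N; rewrite coefM.
  move=> /(submod_sum_term (j := Ordinal ltd) ringD (subring_submod ringD)) /=.
  rewrite addKn mulrC; apply => j nejd; case: (ltngtP j d) => [ltjd|ltdj|eqjd].
  - by rewrite mulrC -coefZ; apply: IHm; lia.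
  - by rewrite nth_default ?mul0r // -(prednK (n := size u)) // size_poly_gt0.
  - by case/eqP: nejd; apply/val_inj.
(* The leading term is removed. As its coefficient is in [D] by [lead], the smaller [u'] still
   multiplies [ps] into D[X], and the outer induction applies. *)
pose u' := g`_i *: u - (g`_i * u`_d) *: 'X^d.
have u'D : forall k, D u'`_k.
  apply: IH.
    have szd : (size u = d.+1)%N by rewrite prednK // size_poly_gt0.
    apply: leq_trans (_ : d.+1 <= n)%N; last by rewrite -szd.
    rewrite ltnS; apply/leq_sizeP => j; rewrite leq_eqVlt coefB !coefZ coefXn.
    case/predU1P => [<-|ltdj]; first by rewrite eqxx mulr1 subrr.
    by rewrite [u`_j]nth_default ?szd // gtn_eqF // !mulr0 subrr.
  move=> h hps k.
  have -> : u' * h = g`_i *: (u * h) - (g`_i * u`_d) *: ('X^d * h).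
    by rewrite mulrBl !scalerAl.
  rewrite coefB !coefZ; apply: DB; apply: DM => //; first exact: psD.
    exact: ups.
  by rewrite coefXnM; case: ifP => // _; exact: psD.
move=> k; have -> : g`_i *: u = u' + (g`_i * u`_d) *: 'X^d by rewrite subrK.
rewrite coefD coefZ coefXn; apply: subringD => //; apply: DM => //.
by case: (k == d).
Qed.

End Polyset.

(** * Fractions of polynomials and irreducible factors of their denominators *)

Lemma fraction_ratio (R : idomainType) (z : {fraction R}) : exists a b : R,
  b != 0 /\ z = FracField.tofrac a / FracField.tofrac b.
Proof.
elim/quotW: z => x; exists (frac x).1, (frac x).2.
have d0 := denom_ratioP x; split => //.
have dF0 : FracField.tofrac (frac x).2 != 0 by rewrite tofrac_eq0.
apply: (mulIf dF0); rewrite divfK //; unlock FracField.tofrac.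
rewrite -[LHS]FracField.pi_mul; apply/eqmodP.
rewrite /= FracField.equivfE /FracField.mulf !numden_Ratio ?oner_eq0 ?mulr1 //.
by apply/eqP; rewrite mulrC.
Qed.

Lemma irreducible_factor (K : fieldType) (b : {poly K}) : (1 < size b)%N ->
  exists2 p : {poly K}, irreducible_poly p & p %| b.
Proof.
have [n] := ubnP (size b); elim: n b => // n IH b /ltnSE szb b1.
have [irr|nirr] := pselect (irreducible_poly b); first by exists b.
have [q [q1 qb nqb]] : exists q : {poly K}, [/\ size q != 1, q %| b & ~~ (q %= b)].
  apply: contrapT => noq; apply: nirr; split => // q q1 qb.
  by apply: contrapT => /negP nqb; apply: noq; exists q.
have b0 : b != 0 by rewrite -size_poly_gt0 ltnW.
have szq : (size q < size b)%N.
  by rewrite ltn_neqAle dvdp_size_eqp // nqb dvdp_leq.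
have q0 : q != 0 by apply: contraTneq qb => ->; rewrite dvd0p.
have [||p irr pq] := IH q; first exact: leq_trans szq szb.
  by rewrite ltn_neqAle eq_sym q1 size_poly_gt0.
by exists p => //; exact: dvdp_trans pq qb.
Qed.

(** Irreducible factors [p] of the denominator [b] are cancelled one by one. If [p] did not divide
    the numerator [a], some [g] in [ps] prime to [p] would satisfy [a * g = b * h], which is
    impossible since [p] divides [b]. *)
Lemma fraction_polynomial (K : fieldType) (ps : seq {poly K})
    (x : {fraction {poly K}}) :
  (forall p : {poly K}, irreducible_poly p -> exists2 g, g \in ps & ~~ (p %| g)) ->
  (forall g, g \in ps -> exists h, x * FracField.tofrac g = FracField.tofrac h) ->
  exists u, x = FracField.tofrac u.
Proof.
move=> ps_coprime xps; have [a [b [b0 xab]]] := fraction_ratio x.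
have {xab} : x * FracField.tofrac b = FracField.tofrac a.
  by rewrite xab divfK // tofrac_eq0.
have [n] := ubnP (size b); elim: n a b b0 => // n IH a b b0 /ltnSE szb xba.
have bF0 : FracField.tofrac b != 0 by rewrite tofrac_eq0.
have [b1|] := leqP (size b) 1.
  have bC := size1_polyC b1; have c0 : b`_0 != 0.
    by apply: contraNneq b0 => c0; rewrite bC c0.
  exists ((b`_0)^-1 *: a); apply: (mulIf bF0); rewrite xba -tofracM.
  congr (FracField.tofrac _).
  by rewrite {2}bC [RHS]mulrC mul_polyC scalerA divff // scale1r.
move=> /irreducible_factor[p irr pb].
have p0 := irredp_neq0 irr.
have pF0 : FracField.tofrac p != 0 by rewrite tofrac_eq0.
have bE := divpK pb; have b'0 : b %/ p != 0.
  by apply: contraNneq b0 => b'0; rewrite -bE b'0 mul0r.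
have [pa|npa] := boolP (p %| a).
  apply: (IH (a %/ p) (b %/ p)) => //.
    apply: leq_trans szb; rewrite size_divp // ltn_subrL size_poly_gt0 b0.
    by have := irr.1; case: size => [|[]].
  by apply: (mulIf pF0); rewrite -mulrA -!tofracM bE (divpK pa).
have [g gps /negP[]] := ps_coprime p irr.
have [h xh] := xps g gps.
have /eqP : FracField.tofrac (a * g) = FracField.tofrac (b * h).
  by rewrite (tofracM b h) -xh mulrCA mulrA xba tofracM.
rewrite tofrac_eq => /eqP ag.
have : p %| a * g by rewrite ag dvdp_mulr.
by rewrite Gauss_dvdpr // irreducible_poly_coprime.
Qed.

(** * GV sequences of D[X] and the primes in [Delta1] *)

Section PolynomialDomain.
Variables (K : fieldType) (D : K -> Prop).
Hypothesis domD : domain_with_qf D.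
Let ringD : subring D := domain_subring domD.
Notation "x %:F" := (@FracField.tofrac _ x).
Notation D1 := (polyset D).
Implicit Types (st : (K -> Prop) -> K -> Prop) (p q : {poly K}).
Implicit Types (ps : seq {poly K}) (s : seq {fraction {poly K}}).

Definition coefs ps : seq K := flatten (map polyseq ps).

Lemma coefsP (P : K -> Prop) ps : P 0 -> (forall c, c \in coefs ps -> P c) <->
  (forall p, p \in ps -> forall i, P p`_i).
Proof.
move=> P0; split=> [Pc p pps i|Pps c /flattenP[_ /mapP[p pps ->] /(nthP 0)[i _ <-]]].
  have [lti|lei] := ltnP i (size p); last by rewrite nth_default.
  by apply: Pc; apply/flattenP; exists (p : seq K); [exact: map_f|exact: mem_nth].
exact: Pps.
Qed.

Lemma poly_common_denominator ps : exists d,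
  [/\ D d, d != 0 & forall p, p \in ps -> D1 (d *: p)%:F].
Proof.
have [d [Dd d0 /(@coefsP (fun c => D (d * c))) dps]] := common_denominator domD (coefs ps).
exists d; split => // p pps; apply/polyset_tofrac => i; rewrite coefZ.
by apply: dps; rewrite ?mulr0 //; exact: subring0.
Qed.

Lemma domain_polyset : domain_with_qf D1.
Proof.
have [? ? ?] := subring_polyset ringD; split => // z.
have [a [b [b0 ->]]] := fraction_ratio z.
have [d [_ d0 dD]] := poly_common_denominator [:: a; b].
exists (d *: a)%:F, (d *: b)%:F; split.
- by apply: dD; rewrite inE eqxx.
- by apply: dD; rewrite !inE eqxx orbT.
- by rewrite tofrac_eq0 scaler_eq0 negb_or d0.
- by rewrite -!mul_polyC !tofracM -mulf_div divff ?mul1r // tofrac_eq0 polyC_eq0.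
Qed.
Let ringD1 : subring D1 := domain_subring domain_polyset.

Lemma polyset_lift s : (forall y, y \in s -> D1 y) -> exists2 ps,
  s = [seq p%:F | p : {poly K} <- ps] & forall p, p \in ps -> forall i, D p`_i.
Proof.
elim: s => [_|y s IH sD]; first by exists [::].
have [p [Dp ->]] := sD y (mem_head _ _).
have [|ps -> psD] := IH; first by move=> x xs; apply: sD; rewrite inE xs orbT.
by exists (p :: ps) => // q; rewrite inE => /predU1P[->|/psD].
Qed.

Lemma coefs_neq0 ps :
  has (fun y => y != 0) [seq p%:F | p : {poly K} <- ps] ->
  has (fun c => c != 0) (coefs ps).
Proof.
move=> /hasP[_ /mapP[p pps ->]]; rewrite tofrac_eq0 => p0.
apply/hasP; exists (lead_coef p); last by rewrite lead_coef_eq0.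
apply/flattenP; exists (p : seq K); first exact: map_f.
by rewrite /lead_coef mem_nth // prednK // size_poly_gt0.
Qed.

(** Testing on constants suffices: [x] in [K] multiplies [ps] into D[X] exactly when it multiplies
    all coefficients into [D]. *)
Lemma gv_seq_coefs ps : gv_seq D1 [seq p%:F | p : {poly K} <- ps] ->
  gv_seq D (coefs ps).
Proof.
have D0 := subring0 ringD.
move=> [psD nzps psG].
have {}psD p : p \in ps -> forall i, D p`_i.
  by move=> pps; apply/polyset_tofrac; apply: psD; exact: map_f.
split; [exact/coefsP | exact: coefs_neq0 |].
move=> x /(@coefsP (fun c => D (x * c))) xps.
apply/(polyset_const _ D0); apply: psG => _ /mapP[p pps ->].
rewrite -tofracM mul_polyC; apply/polyset_tofrac => i; rewrite coefZ.
by apply: xps; rewrite ?mulr0.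
Qed.

(** This prime keeps 0 out of the set of denominators, and makes a sequence contained in no member
    of [Delta1] have a nonzero entry. *)
Lemma zero_Delta1 st : Delta1 D st (fun z => z = 0).
Proof.
have [A1 _ _] := ringD1; split; last first.
  by left=> d [_ /eqP]; rewrite tofrac_eq0 polyC_eq0 => /eqP.
split.
- split => // [x y -> ->|a x _ ->]; [exact: addr0|exact: mulr0].
- by move=> _ ->; exact: subring0.
- by exists 1; split => //; apply/eqP; rewrite oner_neq0.
- by move=> a b _ _ /eqP; rewrite mulf_eq0 => /orP[]/eqP; [left|right].
Qed.

(** The prime is the intersection of pK[X] with D[X]. It meets [D] in zero because a nonconstant
    polynomial divides no nonzero constant. *)
Lemma irreducible_Delta1 st p : irreducible_poly p ->
  Delta1 D st (fun z => exists q, [/\ forall i, D q`_i, p %| q & z = q%:F]).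
Proof.
move=> irr; have p1 : (1 < size p)%N by case: irr.
have D0 := subring0 ringD; have toD1 := polyset_tofrac D.
have [A1 _ AM] := ringD1; have [_ AD _] := subring_submod ringD1.
split; last first.
  left=> d [_ [q [_ pq /eqP]]]; rewrite tofrac_eq => /eqP qd.
  apply/eqP; apply: contraTT pq => d0; rewrite -qd; apply/negP => /dvdp_leq.
  by rewrite polyC_eq0 size_polyC d0 leqNgt p1 => /(_ isT).
split; first split.
- by exists 0; rewrite dvdp0; split => // i; rewrite coef0.
- move=> _ _ [q [Dq pq ->]] [r [Dr pr ->]]; exists (q + r); rewrite tofracD.
  by split => //; [apply/toD1; rewrite tofracD; apply: AD; exact/toD1 | exact: dvdp_add].
- move=> _ _ [a [Da ->]] [q [Dq pq ->]]; exists (a * q); rewrite tofracM.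
  by split => //; [apply/toD1; rewrite tofracM; apply: AM; exact/toD1 | exact: dvdp_mull].
- by move=> _ [q [Dq _ ->]]; exact/toD1.
- exists 1; split => // -[q [_ pq /eqP]]; rewrite -tofrac1 tofrac_eq => /eqP q1.
  by move: pq; rewrite -q1 dvdp1; case: ltngtP p1.
- move=> _ _ [a [Da ->]] [b [Db ->]] [q [_ pq /eqP]].
  rewrite -tofracM tofrac_eq => /eqP abq.
  have [pa|npa] := boolP (p %| a); first by left; exists a.
  right; exists b; split => //.
  by rewrite -(Gauss_dvdpr b (_ : coprimep p a)) ?abq // irreducible_poly_coprime.
Qed.

(** The inclusion of closures is strict because 1 in the closure of the contraction, which is [M],
    would give a GV sequence in [M]. *)
Lemma polyset_Delta1 st M : gv_like D st -> prime_ideal D M -> gv_free D M ->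
  Delta1 D st (polyset M).
Proof.
move=> [stD stG] Mpr Mf; have [[M0 _ _] MD _ _] := Mpr.
have cM d : contr D (polyset M) d <-> M d.
  split=> [[_]|Md]; first by move/polyset_const; exact.
  by split; [exact: MD | exact/polyset_const].
split; first exact: polyset_prime.
right; split; [|split].
- by move=> z; split; apply: polyset_sub => d /cM.
- move=> z [s [sM nzs sz]]; apply/stD.
  by have [|+ _ _] := stG s _ nzs; [move=> y /sM[]|apply].
- exists 1; split; first by apply/stD; case: ringD.
  move=> [s [sM nzs s1]]; have [|_ sG _] := stG s _ nzs; first by move=> y /sM[].
  by apply: (Mf s) (sG s1) => y /sM /cM.
Qed.

(** The polynomial [f] generates the extension of [Q] to K[X]: it is a nonzero element of [Q] of
    least size. *)
Lemma dvdp_minimal (Q : {fraction {poly K}} -> Prop) : submod D1 Q ->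
  set_sub Q D1 -> nonzero Q -> exists f : {poly K},
  [/\ f != 0, Q f%:F & forall g, Q g%:F -> f %| g].
Proof.
move=> mQ QD [x [Qx x0]].
have ex : exists n, `[< exists f : {poly K}, [/\ f != 0, Q f%:F & size f = n] >].
  have [f [_ xf]] := QD x Qx; exists (size f); apply/asboolP; exists f; split => //.
    by rewrite -tofrac_eq0 -xf.
  by rewrite -xf.
case: (ex_minnP ex) => n /asboolP[f [f0 Qf szf]] nmin; exists f; split => // g Qg.
have [d [Dd d0 dq]] := poly_common_denominator [:: g %/ f].
(* The factor [d] clears the denominators of the quotient, which brings a multiple of the remainder
   into [Q]; minimality of [f] then makes the remainder zero. *)
have Qr : Q (d *: (g %% f))%:F.
  have -> : d *: (g %% f) = d%:P * g - (d *: (g %/ f)) * f.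
    by rewrite {2}(divp_eq g f) mul_polyC scalerDr -scalerAl; ring.
  rewrite tofracB !tofracM; have [_ _ QM] := mQ.
  apply: submodB ringD1 mQ _ _; apply: QM => //.
    by apply/polyset_const => //; exact: subring0.
  by apply: dq; rewrite inE.
apply/modp_eq0P/eqP; apply: contraT => r0.
have /nmin : `[< exists h : {poly K}, [/\ h != 0, Q h%:F & size h = size (g %% f)] >].
  apply/asboolP; exists (d *: (g %% f)); split => //.
    by rewrite scaler_eq0 negb_or d0.
  by rewrite size_scale.
by rewrite leqNgt -szf ltn_modpN0.
Qed.

Lemma gv_seq_notin_Delta1 st s Q : gv_like D st -> gv_seq D1 s ->
  Delta1 D st Q -> ~ (forall y, y \in s -> Q y).
Proof.
move=> stG sG [Qpr Qst] sQ; have [sD _ _] := sG.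
have [mQ QD _ _] := Qpr; have [_ nzs xsD] := sG.
have nzQ : nonzero Q by have /hasP[y /sQ Qy y0] := nzs; exists y.
have [ps psE psD] := polyset_lift sD.
case: Qst => [Q0|[QE [_ [z [Dz nz]]]]].
  (* Case of zero contraction. Since [f] divides all of [s], a common denominator [d] of the
     quotients makes [d / f] multiply [s] into D[X], so [d / f] is itself in D[X]. *)
  have [f [f0 Qf fdvd]] := dvdp_minimal mQ QD nzQ.
  have [d [Dd d0 dq]] := poly_common_denominator [seq p %/ f | p <- ps].
  have fF0 : f%:F != 0 by rewrite tofrac_eq0.
  have [h [Dh /(congr1 (fun x => x * f%:F))]] : D1 ((d%:P)%:F / f%:F).
    apply: xsD => y ys; have := sQ y ys; move: ys; rewrite psE => /mapP[p pps ->] Qp.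
    have -> : (d%:P)%:F / f%:F * p%:F = (d *: (p %/ f))%:F.
      rewrite -{1}(divpK (fdvd p Qp)) -mul_polyC !tofracM.
      by rewrite [_ * f%:F]mulrC mulrA divfK.
    by apply: dq; exact: map_f.
  rewrite divfK // -tofracM => /eqP; rewrite tofrac_eq => /eqP dE.
  (* Now [f] divides the nonzero constant [d], so it is a constant in the contraction of [Q], which
     forces it to be zero. *)
  have fC : f = (f`_0)%:P.
    apply: size1_polyC; have : f %| d%:P by rewrite dE dvdp_mulIr.
    by move=> /dvdp_leq; rewrite polyC_eq0 d0 size_polyC d0; apply.
  have Df : D f`_0 by apply/(polyset_tofrac D f): 0%N; exact: QD.
  have f00 : f`_0 = 0 by apply: Q0; split => //; rewrite /embK -fC.
  by move: f0; rewrite fC f00 eqxx.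
(* Case of an extended prime. The coefficients form a GV sequence in the contraction, whose closure
   then contains all of the closure of [D], against strictness. *)
have psG : gv_seq D (coefs ps) by apply: gv_seq_coefs; rewrite -psE.
have [csD nzc _] := psG; have [stD /(_ _ csD nzc)[_ _ st1]] := stG.
apply: nz; exists (coefs ps); split => //; last by apply: st1 => //; exact/stD.
have [Q00 _ _] := mQ; have D0 := subring0 ringD.
apply/coefsP; first by split => //; rewrite /embK tofrac0.
move=> p pps; apply/polyset_tofrac; apply/QE; apply: sQ; rewrite psE.
exact: map_f.
Qed.

Lemma Delta1_gv_seq st s : gv_like D st -> (forall y, y \in s -> D1 y) ->
  (forall Q, Delta1 D st Q -> ~ (forall y, y \in s -> Q y)) -> gv_seq D1 s.
Proof.
move=> stG sD sD1.
have nzs : has (fun y => y != 0) s.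
  apply: contrapT => nz; apply: (sD1 _ (zero_Delta1 st)) => y ys.
  by apply/eqP; apply: contraT => y0; case: nz; apply/hasP; exists y.
split => // x xs.
have [ps psE psD] := polyset_lift sD; have D0 := subring0 ringD.
have psF p : p \in ps -> p%:F \in s by rewrite psE; exact: map_f.
have [u xu] : exists u, x = u%:F.
  apply: (@fraction_polynomial _ ps) => [p irr|g /psF/xs[h [_ ->]]]; last by exists h.
  apply: contrapT => np; apply: (sD1 _ (irreducible_Delta1 st irr)) => y ys.
  move: ys; rewrite psE => /mapP[g gps ->]; exists g; split => //; first exact: psD.
  by apply: contrapT => /negP npg; apply: np; exists g.
(* Otherwise the coefficients lie in a maximal quasi-t-ideal [M] of [D], and M[X] would be a member
   of [Delta1] containing [s]. *)
have csG : gv_seq D (coefs ps).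
  apply: contrapT => ncs.
  have csD : forall c, c \in coefs ps -> D c by apply/coefsP.
  have nzc : has (fun c => c != 0) (coefs ps) by apply: coefs_neq0; rewrite -psE.
  have [||M [csM _ Mpr Mf]] := exists_t_maximal domD (I := span D (coefs ps)).
  - split; first exact: span_submod.
      by move=> c; apply: (@span_min _ D D D) => //; exact: subring_submod.
    by move=> s' s'c /(gv_seq_span domD csD nzc s'c).
  - by have /hasP[c ccs c0] := nzc; exists c; split => //; exact: mem_span.
  case: (sD1 _ (polyset_Delta1 stG Mpr Mf)) => y; rewrite psE => /mapP[p pps ->].
  apply/polyset_tofrac; move: p pps; apply/coefsP; first by case: Mpr => [[]].
  by move=> c ccs; apply: csM; exact: mem_span.
rewrite xu; apply/polyset_tofrac; apply: (mccoy ringD psD).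
  move=> k kps; have [_ _ G] := csG; apply: G; apply/(@coefsP (fun c => D (k * c))).
    by rewrite mulr0.
  by move=> g gps i; exact: kps.
move=> g gps; apply/polyset_tofrac; rewrite tofracM -xu.
by apply: xs; exact: psF.
Qed.

End PolynomialDomain.

(** * Localization of A[Y] at the polynomials whose coefficients form a GV sequence *)

Section NagataRing.
Variables (L : fieldType) (A : L -> Prop) (Delta : (L -> Prop) -> Prop).
Hypothesis ringA : subring A.
Hypothesis Delta_prime : forall Q, Delta Q -> prime_ideal A Q.
Hypothesis Delta_zero : Delta (fun z => z = 0).
Hypothesis Delta_gv : forall s, (forall y, y \in s -> A y) ->
  gv_seq A s <-> forall Q, Delta Q -> ~ (forall y, y \in s -> Q y).
Notation "x %:F" := (@FracField.tofrac _ x).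
Implicit Types (E Q : L -> Prop) (p : {poly L}).

(** For [A] equal to D[X] and [Delta] equal to [Delta1 D st] this unfolds to [S1]. *)
Definition Nagata_denom : {fraction {poly L}} -> Prop := fun z =>
  polyset A z /\ forall Q, Delta Q -> ~ polyset Q z.

Lemma nth_memP E (p : seq L) : E 0 ->
  (forall i, E p`_i) <-> (forall y, y \in p -> E y).
Proof.
move=> E0; split=> [Ep y /(nthP 0)[i _ <-]//|Ep i].
by have [/(mem_nth 0)/Ep//|lei] := ltnP i (size p); rewrite nth_default.
Qed.

Lemma Nagata_denomP p : Nagata_denom p%:F <-> gv_seq A p.
Proof.
have A0 := subring0 ringA.
have Q0 Q : Delta Q -> Q 0 by move=> /Delta_prime[[]].
split=> [[/polyset_tofrac/(nth_memP _ A0) pA pQ]|pG].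
  apply/(Delta_gv pA) => Q HQ pQ'; apply: (pQ Q HQ).
  by apply/polyset_tofrac/nth_memP => //; exact: Q0.
have [pA _ _] := pG; split; first by apply/polyset_tofrac/nth_memP.
move=> Q HQ /polyset_tofrac/(nth_memP _ (Q0 Q HQ)).
by move/(Delta_gv pA): pG; apply.
Qed.

Lemma Nagata_denomM x y : Nagata_denom x -> Nagata_denom y -> Nagata_denom (x * y).
Proof.
move=> [Ax xQ] [Ay yQ]; have [_ _ AM] := subring_polyset ringA.
split=> [|Q HQ]; first exact: AM.
have [_ _ _ QM] := polyset_prime ringA (Delta_prime HQ).
by move=> /(QM x y Ax Ay)[]; [exact: xQ|exact: yQ].
Qed.

Lemma Nagata_denom1 : Nagata_denom 1.
Proof.
have [A1 _ _] := subring_polyset ringA; split => // Q HQ.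
have [[Q0 _ QM] _ [u [Au nQu]] _] := Delta_prime HQ.
rewrite -tofrac1 -polyC1 => /(polyset_const _ Q0) Q1.
by apply: nQu; rewrite -[u]mulr1; exact: QM.
Qed.

Lemma Nagata_denom0 : ~ Nagata_denom 0.
Proof.
move=> [_ /(_ _ Delta_zero)]; apply.
by rewrite -tofrac0; apply/polyset_tofrac => i; rewrite coef0.
Qed.

(** The A[Y]-module generated by [E] is E[Y]; polynomials are built up by Horner's scheme. *)
Lemma genmod_polyset E z : submod A E ->
  genmod (polyset A) (fun y => exists e, E e /\ y = (e%:P)%:F) z <-> polyset E z.
Proof.
move=> mE; have [E0 ED EM] := mE; split.
  have [P0 PD PM] := polyset_submod mE.
  elim/genmod_ind => [//|b _ {}z Ab [e [Ee ->]] Ez]; apply: PD => //.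
  by apply: PM => //; apply/polyset_const.
move=> [p [pE ->]]; elim/poly_ind: p pE => [|p c IH] pE.
  rewrite tofrac0; exact: genmod0.
have pE' i : E p`_i by have := pE i.+1; rewrite coefD coefMX coefC addr0.
have Ec : E c by have := pE 0%N; rewrite coefD coefMX coefC add0r.
have [A1 _ AM] := subring_polyset ringA.
rewrite tofracD addrC -[_%:F]mul1r tofracM [p%:F * _]mulrC.
apply: genmod_cons => //; first by exists c.
apply: genmod_mul (IH pE') => b Ab; apply: AM => //.
apply/polyset_tofrac => i; rewrite coefX.
by case: (i == 1%N); [case: ringA|exact: subring0].
Qed.

(** A denominator [g] clears [z] into E[Y] exactly when each coefficient of [g] multiplies [z] into
    [E], and these coefficients form a GV sequence. *)
Lemma genmod_NagataP E z : submod A E ->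
  genmod (locS (polyset A) Nagata_denom)
    (fun y => exists e, E e /\ y = (e%:P)%:F) (z%:P)%:F <->
  exists2 s, gv_seq A s & forall y, y \in s -> E (z * y).
Proof.
move=> mE; have [E0 _ _] := mE.
have Nsub : set_sub Nagata_denom (polyset A) by move=> x [].
have locP := genmod_locS (fun y => exists e, E e /\ y = (e%:P)%:F) (z%:P)%:F
  (subring_polyset ringA) Nagata_denom1 Nagata_denomM Nsub Nagata_denom0.
have gE p : polyset E (p%:F * (z%:P)%:F) <->
    forall y, y \in (p : seq L) -> E (z * y).
  rewrite -tofracM mulrC mul_polyC.
  split=> [/polyset_tofrac zp|zp].
    by apply/(@nth_memP (fun y => E (z * y))) => [|i]; rewrite ?mulr0 // -coefZ.
  apply/polyset_tofrac => i; rewrite coefZ; move: i.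
  by apply/(@nth_memP (fun y => E (z * y))); rewrite ?mulr0.
split.
  move=> /locP[g Sg]; have [[p [_ gp]] _] := Sg; move: Sg; rewrite gp.
  by move=> /Nagata_denomP pG /(genmod_polyset _ mE)/gE zp; exists p.
move=> [s sG zs]; apply/locP.
have A0 := subring0 ringA; have [sA nzs sX] := sG.
(* [Poly] drops the trailing zeros of [s], so the two sequences have the same entries only up to 0;
   hence the assumption [B 0]. *)
have sPoly (B : L -> Prop) : B 0 -> (forall y, y \in (Poly s : seq L) -> B y) <->
    (forall y, y \in s -> B y).
  move=> B0; split=> Bs; apply/(nth_memP _ B0) => i.
    by rewrite -coef_Poly; move: i; apply/nth_memP.
  by rewrite coef_Poly; move: i; apply/nth_memP.
exists (Poly s)%:F.
  apply/Nagata_denomP => //; split.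
  - exact/sPoly.
  - have /hasP[y ys y0] := nzs.
    apply: contrapT => nz; move: y0; suff -> : y = 0 by rewrite eqxx.
    move: y ys; apply/(sPoly (fun y => y = 0)) => // y yp; apply/eqP.
    by apply: contraT => y0; case: nz; apply/hasP; exists y.
  - move=> x /(sPoly (fun y => A (x * y))) xs; apply: sX; apply: xs.
    by rewrite mulr0.
apply/(genmod_polyset _ mE)/gE.
by apply/(sPoly (fun y => E (z * y))); rewrite ?mulr0.
Qed.

End NagataRing.

(** * The brackets and w on D[X], all described by GV sequences of D[X] *)

Lemma bracketP (K : fieldType) (D : K -> Prop) st
    (E : {fraction {poly K}} -> Prop) z :
  domain_with_qf D -> gv_like D st -> submod (D1 D) E ->
  bracket D st E z <->
  exists2 s, gv_seq (D1 D) s & forall y, y \in s -> E (z * y).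
Proof.
move=> domD stG mE.
apply: (@genmod_NagataP _ _ (Delta1 D st)) => //.
- exact: domain_subring (domain_polyset domD).
- by move=> Q [].
- exact: zero_Delta1.
- move=> s sD; split=> [sG Q HQ|]; last exact: Delta1_gv_seq.
  exact: (gv_seq_notin_Delta1 domD stG sG HQ).
Qed.

Theorem theorem2p3 (K : fieldType) (D : K -> Prop) :
  domain_with_qf D ->
  forall E : {fraction {poly K}} -> Prop, nz_submod (D1 D) E ->
  [/\ set_eq (bracket D (w_op D) E) (bracket D (t_op D) E),
      set_eq (bracket D (t_op D) E) (bracket D (v_op D) E),
      set_eq (bracket D (v_op D) E) (tilde (D1 D) (v_op (D1 D)) E) &
      set_eq (tilde (D1 D) (v_op (D1 D)) E) (w_op (D1 D) E)].
Proof.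
move=> domD E nzE; have [mE _] := nzE; have domD1 := domain_polyset domD.
have vP z := bracketP z domD (v_op_gv_like domD) mE.
have tP z := bracketP z domD (t_op_gv_like domD) mE.
have wP z := bracketP z domD (w_op_gv_like domD) mE.
have wD1P z := w_opP domD1 z nzE.
(* The fourth equality holds by definition of [w_op]. *)
split=> z //.
- exact: iff_trans (wP z) (iff_sym (tP z)).
- exact: iff_trans (tP z) (iff_sym (vP z)).
- exact: iff_trans (vP z) (iff_sym (wD1P z)).
Qed.
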